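(* Let $V$ be the continuous piecewise affine function with $V(x)=g_k^\top x+b_k$ for $x\in Y_k$, $k\in\{0,\dots,m\}$. For $k\in\{1,\dots,m\}$ let $\{y_{k,l}\}_{l=1}^{\nu_k}$ be the set of vertices of $Y_k$, so that $Y_k=\mathrm{co}\{y_{k,l}\}_{l=1}^{\nu_k}$. Suppose that for every $k\in\{1,\dots,m\}$ there is a family $\{\gamma_{i,k}\}_{i=1}^n\subset\mathbb{R}^d$ with $$\sum_{i=1}^n\gamma_{i,k}=g_k$$ and, for all $l\in\{1,\dots,\nu_k\}$, $$\sum_{i=1}^n\Big(f_i^\top\gamma_{i,k}+M\,\|\gamma_{i,k}\|^*\,\|x_i-y_{k,l}\|\Big)<0 .$$ Then for all $a\in\mathbb{R}$ such that $L_a^V\subset X$, it holds that $L_a^V\subset R$, i.e. $$\forall\, x_0\in L_a^V,\qquad \lim_{t\to\infty}\|x(t|x_0)\|=0 .$$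
   Context: Setting. $X\subset\mathbb{R}^d$ is a bounded open set and $f:X\to\mathbb{R}^d$ is a vector field. The system is $\dot x=f(x)$ with the constraint $x(t)\in X$ for all $t\ge 0$. $\|\cdot\|$ is the $q$-norm on $\mathbb{R}^d$ for a fixed $q\in[1,\infty]$ and $\|\cdot\|^*$ is its dual norm, the $q'$-norm with $q'=q/(q-1)$ (with $q'=\infty$ if $q=1$ and $q'=1$ if $q=\infty$). Standing assumptions: 1. $f$ is Lipschitz continuous on $X$, and $x(t|x_0)$ denotes the solution at time $t$ with $x(0)=x_0$. $f$ has a single equilibrium point in $X$, which is the origin $0$, and it is locally asymptotically stable. 2. A finite dataset $D=\{(x_i,f_i)\}_{i=1}^n\subset X\times\mathbb{R}^d$ with $f_i=f(x_i)$ is given. 3. $A$ is a compact set with $A\subset\mathrm{int}(R)$ and $0\in\mathrm{int}(A)$, where $R=\{x_0\in X:\lim_{t\to\infty}\|x(t|x_0)\|=0\}$ is the region of attraction (trajectories being solutions of the constrained system, i.e. defined and staying in $X$ for all $t\ge0$). 4. $\overline X$ and $A$ are polytopes, a polytope being a bounded finite union of polyhedra (finite intersections of half-spaces), not necessarily convex. 5. $M>0$ is a known constant such that $\|f(x)-f(y)\|\le M\|x-y\|$ for all $x,y\in X$. Tessellation. $Y_1,\dots,Y_m$ are convex polytopes with $\overline{X\setminus A}=\bigcup_{k=1}^m Y_k$ and $\mathrm{int}(Y_k)\cap\mathrm{int}(Y_{k'})=\varnothing$ for $k\ne k'$; and $Y_0=A$. Lyapunov candidate. $g_k\in\mathbb{R}^d$,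 $b_k\in\mathbb{R}$ ($0\le k\le m$) are such that the function $V$ with $V(x)=g_k^\top x+b_k$ for $x\in Y_k$ is well defined and continuous (in particular $(g_k-g_{k'})^\top y=b_{k'}-b_k$ at every common vertex $y$ of $Y_k$ and $Y_{k'}$). $V$ is then Lipschitz, and it is extended to a Lipschitz continuous function on $\mathbb{R}^d$ with the same Lipschitz constant, still denoted $V$. $L_a^V=\{x\in\mathbb{R}^d:V(x)<a\}$; $\mathrm{co}$ denotes the convex hull. *)

(* Defs.v *)
From HB Require Import structures.
From mathcomp Require Import all_boot all_order all_algebra.
From mathcomp Require Import all_classical all_reals all_analysis.
Import Order.TTheory GRing.Theory Num.Theory.
Import numFieldNormedType.Exports.

Set Implicit Arguments.
Unset Strict Implicit.
Unset Printing Implicit Defensive.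

Local Open Scope classical_set_scope.
Local Open Scope ring_scope.

Section Definitions.
Context {R : realType} {d : nat}.
Implicit Types (q : \bar R) (X S : set 'rV[R]_d).

Definition dotp (u v : 'rV[R]_d) : R := \sum_i u ord0 i * v ord0 i.

(* Meaningful for 1 <= q <= +oo (the branch -oo is junk); the ambient norm
   `|x| of 'rV[R]_d is the maximum norm. The topology on 'rV[R]_d is the
   library one, which every q-norm induces. *)
Definition qnorm q (x : 'rV[R]_d) : R :=
  match q with
  | EFin p => (\sum_i `|x ord0 i| `^ p) `^ p^-1
  | _ => `|x|
  end.

Definition qnorm_lipschitz q (L : R) S (V : 'rV[R]_d -> R) : Prop :=
  forall x y, S x -> S y -> `|V x - V y| <= L * qnorm q (x - y).

(* Solutions of x' = f(x) subject to x(t) \in X for all t >= 0. Values at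
   negative times are irrelevant, so the equation is imposed at t > 0 and at
   t = 0 only continuity from the right is required (for f continuous on X the
   right derivative at 0 is then f (x 0)). When f is Lipschitz on X, such a
   solution is unique on [0, +oo[; it need not exist. *)
Definition trajectory X (f : 'rV[R]_d -> 'rV[R]_d)
    (x0 : 'rV[R]_d) (x : R -> 'rV[R]_d) : Prop :=
  [/\ x 0 = x0,
      forall t : R, 0 <= t -> X (x t),
      {within `[0, +oo[, continuous x} &
      forall t : R, 0 < t -> is_derive t 1 x (f (x t))].

Definition region_of_attraction q X (f : 'rV[R]_d -> 'rV[R]_d) :
    set 'rV[R]_d :=
  [set x0 | X x0 /\
    exists2 x, trajectory X f x0 x & qnorm q (x t) @[t --> +oo%R] --> (0 : R)].

(* Stability includes the existence for all time of the trajectories issued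
   from points close to 0; by uniqueness the existential form loses nothing. *)
Definition locally_asymptotically_stable0 q X (f : 'rV[R]_d -> 'rV[R]_d) :
    Prop :=
  (forall e : R, 0 < e -> exists2 delta : R, 0 < delta &
     forall x0, qnorm q x0 < delta ->
       exists2 x, trajectory X f x0 x &
         forall t : R, 0 <= t -> qnorm q (x t) < e) /\
  (exists2 delta : R, 0 < delta &
     forall x0, qnorm q x0 < delta -> region_of_attraction q X f x0).

Definition polyhedron S : Prop :=
  exists (p : nat) (c : 'I_p -> 'rV[R]_d) (e : 'I_p -> R),
    S = [set x | forall i, dotp (c i) x <= e i].

Definition polytope S : Prop :=
  bounded_set S /\
  exists (p : nat) (P : 'I_p -> set 'rV[R]_d),
    (forall i, polyhedron (P i)) /\ S = \bigcup_i P i.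

Definition convex_polytope S : Prop :=
  polytope S /\ convex_set (S : set (convex_lmodType 'rV[R]_d)).

(* The vertices of a convex polytope are its extreme points. *)
Definition vertices S : set 'rV[R]_d :=
  [set y | S y /\
    forall (u v : 'rV[R]_d) (t : R), S u -> S v -> 0 < t -> t < 1 ->
      y = t *: u + (1 - t) *: v -> u = v].

End Definitions.

(* Main.v *)
(* On each cell Y_k the vertex inequality is the negativity at the vertices of a
   convex function of x that dominates g_k . f(x): by the Lipschitz bound and
   Hoelder's inequality, g_k . f(x) = sum_i gamma_i . f(x) is at most
   sum_i (f_i . gamma_i + M |gamma_i|^* |x_i - x|). A convex function on a compact
   set is maximal at some vertex, so V decreases at a uniform rate along solutions
   as long as they remain in X \ A. A solution starting in a sublevel set contained
   in X therefore cannot leave it before reaching A, and must reach A since V is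
   bounded below on X; from A on, it is attracted to the origin.

   Solutions are obtained on all of [0, +oo[ by first extending f to a globally
   Lipschitz field F, so that only a posteriori are they shown to remain in X. *)
Require Import Defs.
From HB Require Import structures.
From mathcomp Require Import all_boot all_order all_algebra.
From mathcomp Require Import all_classical all_reals all_analysis.
From mathcomp Require Import ring lra.
Import Order.TTheory GRing.Theory Num.Theory.
Import numFieldNormedType.Exports.

Set Implicit Arguments.
Unset Strict Implicit.
Unset Printing Implicit Defensive.

Local Open Scope classical_set_scope.
Local Open Scope ring_scope.

(** * The q-norms *)

Section QNorm.
Context {R : realType} {d : nat}.
Implicit Types (q : \bar R) (u v x : 'rV[R]_d).

Lemma ler_coord_norm x i : `|x ord0 i| <= `|x|.
Proof. by rewrite [leRHS]/Num.norm/= mx_normrE; exact: (le_bigmax _ _ (ord0, i)). Qed.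

Lemma rV_norm_le x (e : R) : 0 <= e -> (forall i, `|x ord0 i| <= e) -> `|x| <= e.
Proof.
move=> e0 xe; rewrite [leLHS]/Num.norm/= mx_normrE; apply: bigmax_le => //.
by move=> -[j i] _ /=; rewrite ord1.
Qed.

(** Discards the junk branch -oo of [qnorm], so that each fact is checked for the maximum norm and
    for finite exponents. *)
Lemma ge1_ereal_ind (P : \bar R -> Prop) : P +oo%E ->
  (forall p : R, 1 <= p -> P p%:E) -> forall q, (1 <= q)%E -> P q.
Proof. by move=> Py Pp [p||] //=; rewrite lee_fin => /Pp. Qed.

Lemma qnorm_ge0 q x : 0 <= qnorm q x.
Proof. by case: q => [p||] /=; rewrite ?powR_ge0. Qed.

Lemma qnorm_coord_ge q x i : (1 <= q)%E -> `|x ord0 i| <= qnorm q x.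
Proof.
move: q; apply: ge1_ereal_ind => [|p p1] /=; first exact: ler_coord_norm.
have p0 : 0 < p by apply: lt_le_trans p1.
have -> : `|x ord0 i| = (`|x ord0 i| `^ p) `^ p^-1.
  by rewrite -powRrM mulfV ?gt_eqF// powRr1.
apply: ge0_ler_powR; rewrite ?nnegrE ?invr_ge0 ?powR_ge0// ?(ltW p0)//.
  by apply: sumr_ge0 => *; exact: powR_ge0.
by rewrite (bigD1 i)//= lerDl sumr_ge0// => *; exact: powR_ge0.
Qed.

Lemma norm_le_qnorm q x : (1 <= q)%E -> `|x| <= qnorm q x.
Proof.
by move=> q1; apply: rV_norm_le => [|i]; [exact: qnorm_ge0|exact: qnorm_coord_ge].
Qed.

(** The constant is d^(1/q), written as the norm of the all-ones vector to cover every q at once. *)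
Lemma qnorm_le_norm q x : (1 <= q)%E ->
  qnorm q x <= qnorm q (const_mx 1 : 'rV[R]_d) * `|x|.
Proof.
move: q; apply: ge1_ereal_ind => [|p p1] /=.
  (* In dimension 0 the all-ones vector has norm 0, not 1. *)
  have [i _|d0] := pickP 'I_d; last first.
    have -> : x = 0 by apply/rowP => i; have := d0 i.
    by rewrite normr0 mulr0.
  rewrite -[leLHS]mul1r ler_wpM2r//.
  by have := ler_coord_norm (const_mx 1) i; rewrite mxE normr1.
have p0 : 0 < p by apply: lt_le_trans p1.
have -> : `|x| = (`|x| `^ p) `^ p^-1.
  by rewrite -powRrM mulfV ?gt_eqF// powRr1.
rewrite -powRM ?powR_ge0//; last by apply: sumr_ge0 => *; exact: powR_ge0.
have s0 z : 0 <= \sum_i `|(z : 'rV[R]_d) ord0 i| `^ p.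
  by apply: sumr_ge0 => *; exact: powR_ge0.
apply: ge0_ler_powR; rewrite ?nnegrE ?invr_ge0 ?mulr_ge0 ?powR_ge0// ?(ltW p0)//.
rewrite mulr_suml; apply: ler_sum => i _; rewrite mxE normr1 powR1 mul1r.
by apply: ge0_ler_powR; rewrite ?nnegrE ?(ltW p0)// ler_coord_norm.
Qed.

Lemma qnormZ q (a : R) x : (1 <= q)%E -> qnorm q (a *: x) = `|a| * qnorm q x.
Proof.
move: q; apply: ge1_ereal_ind => [|p p1] /=; first exact: normrZ.
have p0 : 0 < p by apply: lt_le_trans p1.
have -> : `|a| = (`|a| `^ p) `^ p^-1.
  by rewrite -powRrM mulfV ?gt_eqF// powRr1.
rewrite -powRM ?powR_ge0//; last by apply: sumr_ge0 => *; exact: powR_ge0.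
by congr (_ `^ _); rewrite mulr_sumr; apply: eq_bigr => i _; rewrite mxE normrM powRM.
Qed.

Lemma qnorm_eq0 q x : (1 <= q)%E -> qnorm q x = 0 -> x = 0.
Proof. by move=> q1 x0; apply/eqP; rewrite -normr_le0 -x0 norm_le_qnorm. Qed.

Lemma qnormN q x : (1 <= q)%E -> qnorm q (- x) = qnorm q x.
Proof. by move=> q1; rewrite -scaleN1r qnormZ// normrN1 mul1r. Qed.

Lemma powR_convex (p t a b : R) : 1 <= p -> 0 <= t <= 1 -> 0 <= a -> 0 <= b ->
  (t * a + (1 - t) * b) `^ p <= t * a `^ p + (1 - t) * b `^ p.
Proof.
move=> p1 t01 a0 b0.
have := @convex_powR R p p1 (Itv01 (proj1 (andP t01)) (proj2 (andP t01))) a b.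
rewrite !inE/= !in_itv/= a0 b0 => /(_ isT isT).
by rewrite !convRE.
Qed.

(** Minkowski's inequality: (u + v) / (A + B) is the convex combination of the unit vectors u / A
    and v / B with weight t = A / (A + B), and the p-th power is convex. *)
Lemma qnormD q u v : (1 <= q)%E -> qnorm q (u + v) <= qnorm q u + qnorm q v.
Proof.
move: q; apply: ge1_ereal_ind => [|p p1]; first exact: ler_normD.
have q1 : (1 <= p%:E)%E by rewrite lee_fin.
have p0 : 0 < p by apply: lt_le_trans p1.
have [A AE] : exists A, A = qnorm p%:E u := ex_intro _ _ erefl.
have [B BE] : exists B, B = qnorm p%:E v := ex_intro _ _ erefl.
rewrite -AE -BE.
have A0 : 0 <= A by rewrite AE qnorm_ge0.
have B0 : 0 <= B by rewrite BE qnorm_ge0.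
have [Az|/eqP Anz] := eqVneq A 0.
  have -> : u = 0 by apply: (@qnorm_eq0 p%:E); rewrite -?AE.
  by rewrite add0r -BE lerDr.
have [Bz|/eqP Bnz] := eqVneq B 0.
  have -> : v = 0 by apply: (@qnorm_eq0 p%:E); rewrite -?BE.
  by rewrite addr0 -AE lerDl.
have {A0}A0 : 0 < A by rewrite lt_neqAle A0 andbT eq_sym; exact/eqP.
have {B0}B0 : 0 < B by rewrite lt_neqAle B0 andbT eq_sym; exact/eqP.
have AB0 : 0 < A + B by rewrite addr_gt0.
have sumE z : (qnorm p%:E z) `^ p = \sum_i `|z ord0 i| `^ p.
  rewrite /= -powRrM mulVf ?gt_eqF// powRr1//.
  by apply: sumr_ge0 => *; exact: powR_ge0.
have -> : A + B = ((A + B) `^ p) `^ p^-1.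
  by rewrite -powRrM mulfV ?gt_eqF// powRr1// ltW.
apply: ge0_ler_powR; rewrite ?nnegrE ?invr_ge0 ?powR_ge0// ?(ltW p0)//.
  by apply: sumr_ge0 => *; exact: powR_ge0.
pose t := A / (A + B).
have t1 : 1 - t = B / (A + B) by rewrite /t; field; rewrite gt_eqF.
have t01 : 0 <= t <= 1.
  by rewrite /t ler_pdivrMr// mul1r lerDl (ltW B0) andbT ltW// divr_gt0.
have step i : `|(u + v) ord0 i| `^ p <= (A + B) `^ p *
    (t * (`|u ord0 i| `^ p / A `^ p) + (1 - t) * (`|v ord0 i| `^ p / B `^ p)).
  have dE (a b : R) : 0 <= a -> 0 < b -> a `^ p / b `^ p = (a / b) `^ p.
    move=> a0 b0; rewrite powRM ?invr_ge0 ?(ltW b0)//; congr (_ * _).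
    by rewrite -(powR_inv1 (ltW b0)) -powRrM mulN1r powRN.
  rewrite !dE//.
  apply: le_trans _ (ler_wpM2l (powR_ge0 _ _) (powR_convex p1 t01 _ _));
    try by rewrite divr_ge0// ltW.
  have X0 : 0 <= t * (`|u ord0 i| / A) + (1 - t) * (`|v ord0 i| / B).
    have [t0 t1'] := andP t01.
    by rewrite addr_ge0// mulr_ge0 ?subr_ge0// divr_ge0// ltW.
  rewrite -powRM ?(ltW AB0)//.
  apply: ge0_ler_powR; rewrite ?nnegrE// ?(ltW p0)// ?mulr_ge0 ?(ltW AB0)//.
  have -> : (A + B) * (t * (`|u ord0 i| / A) + (1 - t) * (`|v ord0 i| / B)) =
      `|u ord0 i| + `|v ord0 i|.
    by rewrite t1 /t; field; rewrite !gt_eqF.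
  by rewrite mxE ler_normD.
apply: le_trans (ler_sum _ (fun i _ => step i)) _.
rewrite -mulr_sumr big_split/= -!mulr_sumr -!mulr_suml -!sumE -AE -BE.
have -> : A `^ p / A `^ p = 1 by rewrite mulfV// gt_eqF// powR_gt0.
have -> : B `^ p / B `^ p = 1 by rewrite mulfV// gt_eqF// powR_gt0.
by rewrite !mulr1 addrC subrK mulr1.
Qed.

(** Induction on the list: the tail sums are the p-th and p'-th powers of numbers A and B, so the
    two-term inequality [hoelder2] absorbs one more term. *)
Lemma sum_hoelder (I : Type) (r : seq I) (a b : I -> R) (p p' : R) :
  (forall i, 0 <= a i) -> (forall i, 0 <= b i) ->
  0 < p -> 0 < p' -> p^-1 + p'^-1 = 1 ->
  \sum_(i <- r) a i * b i <= (\sum_(i <- r) a i `^ p) `^ p^-1 *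
                            (\sum_(i <- r) b i `^ p') `^ p'^-1.
Proof.
move=> a0 b0 p0 p'0 pp'; elim: r => [|i r IH].
  by rewrite !big_nil powR0 ?mul0r// invr_eq0 gt_eqF.
rewrite !big_cons.
have root (s : R) (c : I -> R) : 0 < s -> exists2 A, 0 <= A &
    A = (\sum_(j <- r) c j `^ s) `^ s^-1 /\ \sum_(j <- r) c j `^ s = A `^ s.
  move=> s0; exists ((\sum_(j <- r) c j `^ s) `^ s^-1); first exact: powR_ge0.
  split=> //; rewrite -powRrM mulVf ?gt_eqF// powRr1//.
  by apply: sumr_ge0 => *; exact: powR_ge0.
have [A A0 [AE AS]] := root p a p0; have [B B0 [BE BS]] := root p' b p'0.
rewrite -AE -BE in IH; rewrite {}AS {}BS.
by apply: le_trans (hoelder2 (a0 i) A0 (b0 i) B0 p0 p'0 pp'); rewrite lerD2l.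
Qed.

Lemma dotp_le_qnorm q u v : (1 <= q)%E ->
  dotp u v <= qnorm q u * qnorm (hoelder_conjugate q) v.
Proof.
(* The endpoint pair of exponents 1 and +oo, used in both orders. *)
have dual1 (a b : 'rV[R]_d) :
    \sum_i `|a ord0 i| * `|b ord0 i| <= `|a| * qnorm 1%:E b.
  rewrite /= invr1 powRr1; last by apply: sumr_ge0 => *; exact: powR_ge0.
  rewrite mulr_sumr; apply: ler_sum => i _.
  by rewrite powRr1// ler_wpM2r// ler_coord_norm.
move=> q1.
have : dotp u v <= \sum_i `|u ord0 i| * `|v ord0 i|.
  by apply: ler_sum => i _; rewrite -normrM ler_norm.
move=> /le_trans; apply; move: q q1.
apply: ge1_ereal_ind => [|p]; first by rewrite hoelder_conjugatey.
rewrite le_eqVlt => /predU1P[<-|p1].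
  rewrite hoelder_conjugate1 mulrC; under eq_bigr do rewrite mulrC.
  exact: dual1.
have p0 : 0 < p by apply: lt_trans p1.
have pE : hoelder_conjugate p%:E = (p / (p - 1))%:E.
  rewrite /hoelder_conjugate/= eqe gt_eqF//= inver subr_eq0 gt_eqF//.
rewrite pE /=; apply: sum_hoelder => //; first by rewrite divr_gt0 // subr_gt0.
by field; rewrite !gt_eqF ?subr_gt0.
Qed.

Lemma dotpDr u v w : dotp u (v + w) = dotp u v + dotp u w.
Proof. by rewrite /dotp -big_split; apply: eq_bigr => i _; rewrite mxE mulrDr. Qed.

Lemma dotpC u v : dotp u v = dotp v u.
Proof. by apply: eq_bigr => i _; rewrite mulrC. Qed.

Lemma dotp_suml (I : finType) (c : I -> 'rV[R]_d) v :
  dotp (\sum_i c i) v = \sum_i dotp (c i) v.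
Proof.
rewrite /dotp exchange_big/=; apply: eq_bigr => j _.
by rewrite summxE mulr_suml.
Qed.

End QNorm.

(** * Convex functions on polytopes *)

Section Vertices.
Context {R : realType} {d : nat}.
Implicit Types (S K F : set 'rV[R]_d).

Lemma continuous_sum (T : topologicalType) (I : Type) (r : seq I) (P : pred I)
    (h : I -> T -> R) : (forall i, P i -> continuous (h i)) ->
  continuous (fun x => \sum_(i <- r | P i) h i x).
Proof.
move=> hC x; elim: r => [|i r IH].
  by under eq_fun do rewrite big_nil; exact: cvg_cst.
under eq_fun do rewrite big_cons.
by case: ifPn => // Pi; apply: cvgD => //; exact: hC.
Qed.

Lemma continuous_dotp (c : 'rV[R]_d) : continuous (dotp c).
Proof.
apply: continuous_sum => i _ x.
apply: (@continuousM _ _ (cst (c ord0 i))); first exact: cst_continuous.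
exact: coord_continuous.
Qed.

Lemma polyhedron_closed S : polyhedron S -> closed S.
Proof.
move=> [p [c [e ->]]].
have -> : [set x | forall i, dotp (c i) x <= e i] =
    \bigcap_(i in [set: 'I_p]) (dotp (c i) @^-1` [set r | r <= e i]).
  by apply/seteqP; split => x /= h i; [move=> _; exact: h|exact: h i Logic.I].
apply: closed_bigI => i _; apply: preimage_closed (@closed_le _ _) => x _.
exact: continuous_dotp.
Qed.

Lemma polytope_compact S : polytope S -> compact S.
Proof.
move=> [bS [p [P [hP SE]]]]; apply: bounded_closed_compact => //.
rewrite SE; apply: closed_bigcup => [|i _]; first exact: finite_finset.
 exact: polyhedron_closed.
Qed.

Definition convex_fun (phi : 'rV[R]_d -> R) := forall u v (t : R), 0 < t -> t < 1 ->
  phi (t *: u + (1 - t) *: v) <= t * phi u + (1 - t) * phi v.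

Lemma convex_fun_sum (I : Type) (r : seq I) (h : I -> 'rV[R]_d -> R) :
  (forall i, convex_fun (h i)) -> convex_fun (fun x => \sum_(i <- r) h i x).
Proof.
move=> hc u v t t0 t1; rewrite !mulr_sumr -big_split.
by apply: ler_sum => i _; exact: hc.
Qed.

(** Extreme subsets in the sense of Krein and Milman. Extremality is relative to all of [K], so a
    one-point face is a vertex of [K]. *)
Definition compact_face K F := [/\ F `<=` K, F !=set0, compact F &
  forall u v (t : R), K u -> K v -> 0 < t -> t < 1 ->
    F (t *: u + (1 - t) *: v) -> F u /\ F v].

(** If a convex function attains its maximum over F strictly inside a segment of K, both ends lie in
    F because F is extreme, and convexity forces the maximum to be attained at both. *)
Lemma compact_face_argmax K F (phi : 'rV[R]_d -> R) :
  convex_fun phi -> continuous phi -> compact_face K F ->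
  compact_face K [set x | F x /\ forall z, F z -> phi z <= phi x].
Proof.
move=> phic phiC [FK F0 cF Fext].
have [m] := compact_EVT_max F0 cF (continuous_subspaceT phiC).
rewrite inE => Fm mmax.
have {}mmax z : F z -> phi z <= phi m by move=> Fz; apply: mmax; rewrite inE.
split.
- by move=> x [/FK].
- by exists m; split.
- have -> : [set x | F x /\ forall z, F z -> phi z <= phi x] =
      F `&` (phi @^-1` [set r | phi m <= r]).
    apply/seteqP; split => x /= [Fx h]; split => //; first exact: h.
    by move=> z /mmax /le_trans; apply.
  apply: compact_closedI => //; apply: preimage_closed (@closed_ge _ _) => x _.
  exact: phiC.
- move=> u v t Ku Kv t0 t1 [Fw wmax].
  have [Fu Fv] := Fext u v t Ku Kv t0 t1 Fw.
  have := phic u v t t0 t1; have := wmax _ Fu; have := wmax _ Fv; have := wmax _ Fm.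
  set w := phi (_ + _) => mw vw uw wuv.
  by split; split => // z /mmax zm; apply: (le_trans zm); nra.
Qed.

(* Maximising phi and then each coordinate in turn cuts out smaller and smaller
   faces, the last of which is a vertex. *)
Lemma convex_max_at_vertex K (phi : 'rV[R]_d -> R) :
  compact K -> K !=set0 -> convex_fun phi -> continuous phi ->
  exists2 v, vertices K v & forall x, K x -> phi x <= phi v.
Proof.
move=> cK K0 phic phiC.
have faceK : compact_face K K by split.
have := compact_face_argmax phic phiC faceK.
set F0 := [set x | _] => faceF0.
have [F [faceF FF0 Fcoord]] : exists F, [/\ compact_face K F, F `<=` F0 &
    forall i, i \in enum 'I_d -> forall u v, F u -> F v -> u ord0 i = v ord0 i].
  elim: (enum 'I_d) => [|i s [F [faceF FF0 Fcoord]]]; first by exists F0; split.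
  exists [set x | F x /\ forall z, F z -> z ord0 i <= x ord0 i]; split.
  - apply: (@compact_face_argmax K F (fun x => x ord0 i)) => //.
      by move=> u v t _ _; rewrite !mxE.
    exact: coord_continuous.
  - by move=> x [/FF0].
  - move=> j; rewrite inE => /predU1P[->|js] u v [Fu umax] [Fv vmax].
      by apply/eqP; rewrite eq_le umax// vmax.
    exact: Fcoord.
have [FK [v Fv] _ Fext] := faceF.
exists v; last by move=> x Kx; have [_] := FF0 _ Fv; apply.
(* F is extreme, so it contains both ends of any segment of K with v strictly inside; constant
   coordinates make them equal. *)
split=> [|a b t Ka Kb t0 t1 vE]; first exact: FK.
rewrite vE in Fv; have [Fa Fb] := Fext a b t Ka Kb t0 t1 Fv.
by apply/rowP => i; apply: Fcoord => //; rewrite mem_enum.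
Qed.

Lemma qnorm_lipschitz_continuous q (L : R) (V : 'rV[R]_d -> R) : (1 <= q)%E ->
  qnorm_lipschitz q L setT V -> continuous V.
Proof.
move=> q1 VL x.
(* [L] has no prescribed sign; the absolute value and the added 1 make [C] positive. *)
pose C := `|L| * qnorm q (const_mx 1 : 'rV[R]_d) + 1.
have C0 : 0 < C by rewrite ltr_wpDl// mulr_ge0// qnorm_ge0.
have VC u v : `|V u - V v| <= C * `|u - v|.
  apply: (le_trans (VL u v Logic.I Logic.I)).
  apply: (@le_trans _ _ (`|L| * qnorm q (u - v))).
    by rewrite ler_wpM2r ?qnorm_ge0// ler_norm.
  apply: (@le_trans _ _ (`|L| * (qnorm q (const_mx 1 : 'rV[R]_d) * `|u - v|))).
    by rewrite ler_wpM2l// qnorm_le_norm.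
  by rewrite mulrA ler_wpM2r// lerDl.
apply/(@cvgrPdist_lt _ _ _ (nbhs x)) => e e0; near=> z.
apply: le_lt_trans (VC x z) _.
rewrite mulrC -ltr_pdivlMr//.
by near: z; apply: (@cvgr_dist_lt _ _ _ (nbhs x)); [exact: cvg_id|rewrite divr_gt0].
Unshelve. all: by end_near. Qed.

(** The reverse triangle inequality makes the distance to c 1-Lipschitz. *)
Lemma qnorm_continuous (q : \bar R) (c : 'rV[R]_d) : (1 <= q)%E ->
  continuous (fun x : 'rV[R]_d => qnorm q (c - x)).
Proof.
move=> q1; apply: (@qnorm_lipschitz_continuous q 1) => // u v _ _.
rewrite mul1r; have h a b : qnorm q (c - a) - qnorm q (c - b) <= qnorm q (a - b).
  rewrite lerBlDr -(qnormN (a - b))//; apply: le_trans _ (qnormD _ _ q1).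
  by rewrite opprB [in leRHS]addrC subrKA.
by rewrite ler_norml h andbT lerNl opprB -(qnormN (u - v))// opprB.
Qed.

Lemma qnorm_dist_convex (q : \bar R) (c : 'rV[R]_d) : (1 <= q)%E ->
  convex_fun (fun x : 'rV[R]_d => qnorm q (c - x)).
Proof.
move=> q1 u v t t0 t1 /=.
have -> : c - (t *: u + (1 - t) *: v) = t *: (c - u) + (1 - t) *: (c - v).
  by apply/rowP => i; rewrite !mxE; ring.
apply: (le_trans (qnormD _ _ q1)).
by rewrite !qnormZ// !ger0_norm ?subr_ge0// ltW.
Qed.

End Vertices.

(** * Lipschitz extension and antiderivatives *)

Section Calculus.
Context {R : realType} {d : nat}.

(** McShane's extension: x is sent to the infimum over y in X of h y + L |x - y|. *)
Lemma lipschitz_extension_scalar (X : set 'rV[R]_d) (h : 'rV[R]_d -> R) (L : R) :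
  0 <= L -> X !=set0 -> (forall x y, X x -> X y -> `|h x - h y| <= L * `|x - y|) ->
  exists H : 'rV[R]_d -> R, (forall x, X x -> H x = h x) /\
    forall x y, `|H x - H y| <= L * `|x - y|.
Proof.
move=> L0 [x0 Xx0] hL.
pose E x := [set h y + L * `|x - y| | y in X].
(* This lower bound gives [inf] its meaning: without one, [inf] takes a default value. *)
have Elb x z : E x z -> h x0 - L * `|x - x0| <= z.
  move=> [y Xy <-]; have := hL _ _ Xx0 Xy; rewrite ler_norml => /andP[_].
  have tri : `|x0 - y| <= `|x - y| + `|x - x0|.
    by rewrite [leRHS]addrC (distrC x x0) ler_distD.
  by have := ler_wpM2l L0 tri; rewrite mulrDr; lra.
have hlbE x : has_lbound (E x) by exists (h x0 - L * `|x - x0|); exact: Elb.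
have E0 x : E x !=set0 by exists (h x0 + L * `|x - x0|), x0.
exists (fun x => inf (E x)); split=> [x Xx|].
  apply/eqP; rewrite eq_le; apply/andP; split.
    by apply: ge_inf => //; exists x => //; rewrite subrr normr0 mulr0 addr0.
  apply: lb_le_inf => // _ [y Xy <-].
  by have := hL _ _ Xx Xy; rewrite ler_norml => /andP[_]; rewrite lerBlDl.
have half x y : inf (E x) - inf (E y) <= L * `|x - y|.
  rewrite lerBlDr -lerBlDl; apply: lb_le_inf => // _ [z Xz <-].
  rewrite lerBlDl; apply: (@le_trans _ _ (h z + L * `|x - z|)).
    by apply: ge_inf => //; exists z.
  have tri : `|x - z| <= `|x - y| + `|y - z|.
    exact: ler_distD.
  by have := ler_wpM2l L0 tri; rewrite mulrDr; lra.
move=> x y; rewrite ler_norml half andbT lerNl opprB.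
by rewrite distrC half.
Qed.

(** The maximum norm lets the coordinates be extended separately with no loss in the constant. *)
Lemma lipschitz_extension (X : set 'rV[R]_d) (f : 'rV[R]_d -> 'rV[R]_d) (L : R) :
  0 <= L -> X !=set0 -> (forall x y, X x -> X y -> `|f x - f y| <= L * `|x - y|) ->
  exists F : 'rV[R]_d -> 'rV[R]_d, (forall x, X x -> F x = f x) /\
    forall x y, `|F x - F y| <= L * `|x - y|.
Proof.
move=> L0 X0 fL.
have /choice[H HP] (i : 'I_d) : exists H : 'rV[R]_d -> R,
    (forall x, X x -> H x = f x ord0 i) /\ forall x y, `|H x - H y| <= L * `|x - y|.
  apply: lipschitz_extension_scalar => // x y Xx Xy.
  by apply: le_trans (fL _ _ Xx Xy); have := ler_coord_norm (f x - f y) i; rewrite !mxE.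
exists (fun x => \row_i H i x); split=> [x Xx|x y].
  by apply/rowP => i; rewrite mxE; exact: (HP i).1.
apply: rV_norm_le => [|i]; first by rewrite mulr_ge0.
by rewrite !mxE; exact: (HP i).2.
Qed.

Lemma is_derive_rVP (x : R -> 'rV[R]_d) (t : R) (v : 'rV[R]_d) :
  is_derive t 1 x v <-> forall i, is_derive t 1 (fun s => x s ord0 i) (v ord0 i).
Proof.
split=> [xv i|xv].
- have xd : derivable x t 1 by case: xv.
  apply: DeriveDef; first by move/derivable_mxP : xd.
  by case: xv => _ <-; rewrite derive_mx// mxE.
- have xd : derivable x t 1.
    by apply/derivable_mxP => i j; rewrite ord1; case: (xv j).
  apply: (DeriveDef xd); rewrite derive_mx//; apply/rowP => i; rewrite mxE.
  by case: (xv i).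
Qed.

(* Integrating from -1 makes the derivative two-sided also at time 0. *)
Lemma antiderivative_scalar (h : R -> R) : continuous h ->
  exists H : R -> R, H 0 = 0 /\ forall t : R, 0 <= t -> is_derive t 1 H (h t).
Proof.
move=> hC.
pose G x := \int[lebesgue_measure]_(t in `[(-1 : R), x]) h t.
exists (fun t => G t - G 0); split=> [|t t0]; first by rewrite subrr.
have hI (u : R) : lebesgue_measure.-integrable `[(-1 : R), u] (EFin \o h).
  apply: continuous_compact_integrable; first exact: segment_compact.
  exact: continuous_subspaceT.
have N1t : -1 < t by apply: lt_le_trans t0; rewrite ltrN10.
have tt1 : t < t + 1 by rewrite ltrDl.
have [dG GE] := continuous_FTC1_closed tt1 (hI _) N1t (hC t).
have Gd : is_derive t 1 G (h t) by apply: (DeriveDef dG); rewrite -derive1E; exact: GE.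
have := is_deriveB Gd (is_derive_cst (G 0) t 1).
by rewrite subr0.
Qed.

Lemma antiderivative (h : R -> 'rV[R]_d) : continuous h ->
  exists H : R -> 'rV[R]_d, H 0 = 0 /\ forall t : R, 0 <= t -> is_derive t 1 H (h t).
Proof.
move=> hC.
have /choice[H HP] (i : 'I_d) : exists H : R -> R,
    H 0 = 0 /\ forall t : R, 0 <= t -> is_derive t 1 H (h t ord0 i).
  apply: antiderivative_scalar => t.
  exact: (@continuous_comp _ _ _ h (fun x : 'rV_d => x ord0 i) t (hC t)
    (@coord_continuous _ _ _ ord0 i (h t))).
exists (fun t => \row_i H i t); split=> [|t t0].
  by apply/rowP => i; rewrite !mxE; exact: (HP i).1.
apply/is_derive_rVP => i.
under eq_fun do rewrite mxE.
exact: (HP i).2.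
Qed.

Lemma within_continuous_coord (T : topologicalType) (A : set T) (H : T -> 'rV[R]_d) i :
  {within A, continuous H} -> {within A, continuous (fun t => H t ord0 i)}.
Proof.
move=> HC t.
apply: (@continuous_comp _ _ _ (H : subspace A -> _) (fun x : 'rV_d => x ord0 i)).
  exact: HC.
exact: coord_continuous.
Qed.

(** The bound is a primitive of C exp(K t). In the norm weighted by exp(- K t), integration thus
    costs a factor 1 / K. *)
Lemma antiderivative_expR_bound (H h : R -> 'rV[R]_d) (C K T : R) : 0 < K -> 0 <= C ->
  {within `[0, T], continuous H} -> H 0 = 0 ->
  (forall t : R, 0 < t -> t < T -> is_derive t 1 H (h t)) ->
  (forall t : R, 0 < t -> t < T -> `|h t| <= C * expR (K * t)) ->
  forall t, 0 <= t -> t <= T -> `|H t| <= C / K * expR (K * t).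
Proof.
move=> K0 C0 HC H0 dH hC.
(* One-sided scalar comparison: E - u is nonnegative at 0 and nondecreasing. It is applied to each
   coordinate and to its opposite. *)
have main (u u' : R -> R) : {within `[0, T], continuous u} -> u 0 = 0 ->
    (forall t : R, 0 < t -> t < T -> is_derive t 1 u (u' t)) ->
    (forall t : R, 0 < t -> t < T -> u' t <= C * expR (K * t)) ->
    forall t, 0 <= t -> t <= T -> u t <= C / K * expR (K * t).
  move=> uC u0 du u'C t t0 tT.
  pose E s := C / K * expR (K * s).
  have dE (s : R) : is_derive s 1 E (C * expR (K * s)).
    have dK : is_derive s 1 ( *%R K) K.
      have := is_deriveZ K (is_derive_id s (1 : R)).
      by rewrite [_%:A]mulr1.
    have := is_deriveZ (C / K) (is_derive1_comp (is_derive_expR (K * s)) dK).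
    have -> : C / K *: (expR (K * s) * K) = C * expR (K * s).
      by rewrite /GRing.scale/=; field; rewrite gt_eqF.
    by [].
  pose psi := E - u.
  have dpsi (s : R) : s \in `]0, T[%R -> is_derive s 1 psi (C * expR (K * s) - u' s).
    by rewrite in_itv/= => /andP[s0 sT]; apply: is_deriveB; exact: du.
  have psiC : {within `[0, T], continuous psi}.
    move=> s; apply: continuousB; last exact: uC.
    apply: continuous_subspaceT => r; apply/differentiable_continuous.
    by apply/derivable1_diffP; case: (dE r).
  have := @ger0_derive1_le_cc R psi 0 T _ _ psiC 0 t.
  rewrite !in_itv/= lexx t0 tT (le_trans t0 tT) => /(_ _ _ isT isT isT) le0.
  have : psi 0 <= psi t.
    apply: le0 => s sT; first by case: (dpsi s sT).
    rewrite derive1E; have [_ ->] := dpsi s sT.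
    by move: sT; rewrite in_itv/= => /andP[s0 sT]; rewrite subr_ge0 u'C.
  have E0 : 0 <= E 0 by rewrite /E mulr_ge0 ?expR_ge0// divr_ge0// ltW.
  rewrite /psi /= => h1.
  have {h1} : E 0 - u 0 <= E t - u t by [].
  by rewrite u0 subr0 => /(le_trans E0); rewrite subr_ge0.
move=> t t0 tT; apply: rV_norm_le => [|i].
  by rewrite mulr_ge0 ?expR_ge0// divr_ge0// ltW.
have HCi : {within `[0, T], continuous (fun t => H t ord0 i)}.
  exact: within_continuous_coord.
have dHi (s : R) : 0 < s -> s < T -> is_derive s 1 (fun r => H r ord0 i) (h s ord0 i).
  by move=> s0 sT; exact: (proj1 (is_derive_rVP _ _ _) (dH s s0 sT) i).
have hCi s : 0 < s -> s < T -> `|h s ord0 i| <= C * expR (K * s).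
  by move=> s0 sT; apply: le_trans (hC s s0 sT); exact: ler_coord_norm.
rewrite ler_norml; apply/andP; split.
- rewrite lerNl; apply: (main (fun s => - H s ord0 i) (fun s => - h s ord0 i)) => //.
  + by move=> s; apply: continuousN; exact: HCi.
  + by rewrite H0 mxE oppr0.
  + by move=> s s0 sT; apply: is_deriveN; exact: dHi.
  + by move=> s s0 sT; apply: le_trans (hCi s s0 sT); rewrite -normrN ler_norm.
- apply: (main (fun s => H s ord0 i) (fun s => h s ord0 i)) => //.
  + by rewrite H0 mxE.
  + by move=> s s0 sT; apply: le_trans (hCi s s0 sT); exact: ler_norm.
Qed.

End Calculus.

(** * Global solutions of Lipschitz equations *)

Section HalfPowers.
Context {R : realType}.

Lemma le_half_pow (a C : R) : (forall n, a <= C * 2^-1 ^+ n) -> a <= 0.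
Proof.
move=> aC; have h1 : `|2^-1 : R| < 1 by rewrite ger0_norm ?invr_ge0// invf_lt1// ltr1n.
have cv := @cvg_geometric R C (2^-1) h1.
apply: (@ler_cvg_to _ \oo _ R (cst a) (geometric C 2^-1)); [exact: cvg_cst|exact: cv|].
by apply: nearW => n; exact: aC.
Qed.

(** The intervals of centre u n and radius 2 C / 2^n, a bound for the sum of the remaining
    increments, are nested; the supremum of their left ends lies in all of them. *)
Lemma half_pow_limit (u : nat -> R) (C : R) :
  (forall n, `|u n.+1 - u n| <= C * 2^-1 ^+ n) ->
  exists l, forall n, `|u n - l| <= 2 * C * 2^-1 ^+ n.
Proof.
move=> uC.
pose lo n := u n - 2 * C * 2^-1 ^+ n; pose hi n := u n + 2 * C * 2^-1 ^+ n.
have C0 n : 0 <= C * 2^-1 ^+ n by apply: le_trans (uC n).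
have loS n : lo n <= lo n.+1.
  by have := uC n; rewrite ler_norml /lo exprS => /andP[]; lra.
have hiS n : hi n.+1 <= hi n.
  by have := uC n; rewrite ler_norml /hi exprS => /andP[]; lra.
have lo_mono := homo_leq (@lexx _ R) (@le_trans _ R) loS.
have hi_mono m n : (m <= n)%N -> hi n <= hi m.
  move=> /subnKC <-; elim: (n - m)%N => [|k IH]; first by rewrite addn0.
  by rewrite addnS; apply: le_trans (hiS _) IH.
have lohi m n : lo m <= hi n.
  have lh k : lo k <= hi k by rewrite /lo /hi; have := C0 k; lra.
  have [mn|/ltnW nm] := leqP m n; first exact: le_trans (lo_mono _ _ mn) (lh n).
  exact: le_trans (lh m) (hi_mono _ _ nm).
exists (sup (range lo)) => n.
have ub : has_ubound (range lo) by exists (hi 0%N) => _ [k _ <-]; exact: lohi.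
have le1 : lo n <= sup (range lo) by apply: ub_le_sup => //; exists n.
have le2 : sup (range lo) <= hi n.
  by apply: ge_sup; [exists (lo 0%N), 0%N|move=> _ [k _ <-]; exact: lohi].
by move: le1 le2; rewrite /lo /hi ler_norml => h1 h2; apply/andP; split; lra.
Qed.

End HalfPowers.

(** * Picard iteration and uniqueness in an exponentially weighted norm *)

Section ODE.
Context {R : realType} {d : nat}.
Context (F : 'rV[R]_d -> 'rV[R]_d) (L : R).
Context (L0 : 0 < L) (FL : forall x y, `|F x - F y| <= L * `|x - y|).

(** With twice the Lipschitz constant as rate, the Picard operator has ratio L / K = 1/2 in the norm
    weighted by exp(- K t), on the whole half-line at once. *)
Let K := 2 * L.
Let K0 : 0 < K. Proof. by rewrite mulr_gt0. Qed.

Lemma lipschitz_continuous : continuous F.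
Proof.
move=> x; apply/(@cvgrPdist_lt _ _ _ (nbhs x)) => e e0; near=> z.
apply: le_lt_trans (FL x z) _; rewrite mulrC -ltr_pdivlMr//.
by near: z; apply: (@cvgr_dist_lt _ _ _ (nbhs x)); [exact: cvg_id|rewrite divr_gt0].
Unshelve. all: by end_near. Qed.

Lemma is_derive_continuous (x : R -> 'rV[R]_d) (t : R) v : is_derive t 1 x v ->
  {for t, continuous x}.
Proof.
by move=> [xd _]; apply/differentiable_continuous; apply/derivable1_diffP.
Qed.

Lemma continuous_comp_norm (x : R -> 'rV[R]_d) :
  (forall t : R, 0 <= t -> {for t, continuous x}) -> continuous (fun t : R => x `|t|).
Proof.
move=> xC t; apply: (@continuous_comp _ _ _ (fun t : R => `|t|) x).
  exact: norm_continuous.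
exact: xC.
Qed.

(* Functions on [0, +oo[ are represented by t |-> w `|t|, which is continuous
   on the whole line. *)
Lemma ode_exists (x0 : 'rV[R]_d) : exists x : R -> 'rV[R]_d,
  x 0 = x0 /\ forall t : R, 0 <= t -> is_derive t 1 x (F (x t)).
Proof.
(* Choice of a primitive; nothing is claimed of [P h] for discontinuous h, where 0 is a mere
   filler. *)
have /choice[P PP] (h : R -> 'rV[R]_d) : exists H : R -> 'rV[R]_d,
    continuous h -> H 0 = 0 /\ forall t : R, 0 <= t -> is_derive t 1 H (h t).
  have [hC|hC] := pselect (continuous h); last by exists 0.
  by have [H HP] := antiderivative hC; exists H.
(* [T] is the Picard operator; the [w n] below are its iterates from the constant x0. *)
pose T (w : R -> 'rV[R]_d) (t : R) := x0 + P (F \o w) `|t|.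
have FC (w : R -> 'rV[R]_d) : continuous w -> continuous (F \o w).
  move=> wC t.
  exact: (@continuous_comp _ _ _ w F t (wC t) (@lipschitz_continuous (w t))).
have TC (w : R -> 'rV[R]_d) : continuous w -> continuous (T w).
  move=> wC t; apply: (@continuousD _ _ _ (cst x0)); first exact: cst_continuous.
  apply: continuous_comp_norm => s s0.
  by apply: is_derive_continuous; exact: (PP _ (FC _ wC)).2.
have Tbound (w w' : R -> 'rV[R]_d) C : continuous w -> continuous w' -> 0 <= C ->
    (forall t, `|w t - w' t| <= C * expR (K * `|t|)) ->
    forall t, `|T w t - T w' t| <= C / 2 * expR (K * `|t|).
  move=> wC w'C C0 ww' t.
  have [P0 dP] := PP _ (FC _ wC); have [P0' dP'] := PP _ (FC _ w'C).
  have -> : C / 2 = L * C / K by rewrite /K; field; rewrite gt_eqF.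
  have -> : T w t - T w' t = (P (F \o w) - P (F \o w')) `|t|.
    by rewrite /T opprD addrACA subrr add0r.
  apply: (@antiderivative_expR_bound _ _ _ (fun s => F (w s) - F (w' s)) _ _ `|t|) => //.
  - by rewrite mulr_ge0// ltW.
  - apply: derivable_within_continuous => s; rewrite in_itv/= => /andP[s0 _].
    by apply: derivableB; [case: (dP _ s0)|case: (dP' _ s0)].
  - by change (P (F \o w) 0 - P (F \o w') 0 = 0); rewrite P0 P0' subrr.
  - by move=> s /ltW s0 _; apply: is_deriveB; [exact: dP|exact: dP'].
  - move=> s s0 _; apply: le_trans (FL _ _) _; rewrite -mulrA ler_wpM2l ?(ltW L0)//.
    by have := ww' s; rewrite (gtr0_norm s0).
pose w n := iter n T (cst x0).
have wC n : continuous (w n).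
  by elim: n => [|n IH]; [move=> t; exact: cst_continuous|exact: TC].
(* Bounds the first increment, a primitive of the constant F x0. *)
pose B := `|F x0| / K.
have B0 : 0 <= B by rewrite divr_ge0// ltW.
have wS n t : `|w n.+1 t - w n t| <= B * 2^-1 ^+ n * expR (K * `|t|).
  elim: n t => [|n IH] t.
    have [P0 dP] := PP _ (FC _ (wC 0%N)).
    have -> : w 1%N t - w 0%N t = P (F \o w 0%N) `|t|.
      by rewrite /w/= /T addrAC subrr add0r.
    rewrite expr0 mulr1.
    apply: (@antiderivative_expR_bound _ _ _ (fun s => F x0) _ _ `|t|) => //.
    - apply: derivable_within_continuous => s; rewrite in_itv/= => /andP[s0 _].
      by case: (dP _ s0).
    - by move=> s /ltW s0 _; exact: dP.
    - move=> s s0 _; rewrite ler_peMr// -[leLHS]expR0 ler_expR.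
      by rewrite mulr_ge0// ltW.
  rewrite exprS mulrCA (mulrC 2^-1).
  by apply: (Tbound _ _ _ (wC n.+1) (wC n)) => //; rewrite mulr_ge0// exprn_ge0.
have /choice[wlim wlimP] (t : R) : exists l : 'rV[R]_d, forall n,
    `|w n t - l| <= 2 * B * 2^-1 ^+ n * expR (K * `|t|).
  have /choice[l lP] (i : 'I_d) : exists l : R, forall n,
      `|w n t ord0 i - l| <= 2 * (B * expR (K * `|t|)) * 2^-1 ^+ n.
    apply: half_pow_limit => n; rewrite mulrAC; apply: le_trans (wS n t).
    by have := ler_coord_norm (w n.+1 t - w n t) i; rewrite !mxE.
  exists (\row_i l i) => n; apply: rV_norm_le => [|i].
    by rewrite mulr_ge0 ?expR_ge0// mulr_ge0 ?exprn_ge0// mulr_ge0.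
  by rewrite !mxE; apply: le_trans (lP i n) _; rewrite mulrA mulrAC.
(* Three-term estimate: near t the weight is at most exp(K (|t| + 1)), so one n serves all nearby
   times. *)
have wlimC : continuous wlim.
  move=> t; apply/(@cvgrPdist_le _ _ _ (nbhs t)) => e e0.
  pose E := 2 * B * expR (K * (`|t| + 1)).
  have [n nE] : exists n, E * 2^-1 ^+ n <= e / 3.
    apply: contrapT => /forallNP hn; have : e / 3 <= 0.
      by apply: (@le_half_pow _ _ E) => n; apply: ltW; rewrite ltNge; apply/negP/hn.
    by apply/negP; rewrite -ltNge divr_gt0.
  have near_bound s : `|s| <= `|t| + 1 -> `|w n s - wlim s| <= e / 3.
    move=> st; apply: le_trans (wlimP s n) (le_trans _ nE).
    rewrite /E mulrAC ler_wpM2r ?exprn_ge0//.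
    rewrite ler_wpM2l ?(mulr_ge0 _ B0)// ler_expR.
    by rewrite ler_wpM2l// ltW.
  near=> s.
  have h1 : `|w n t - w n s| <= e / 3.
    near: s; apply: (@cvgr_dist_le _ _ _ (nbhs t)); first exact: wC.
    by rewrite divr_gt0.
  have h2 : `|t - s| <= 1.
    by near: s; apply: (@cvgr_dist_le _ _ _ (nbhs t)); first exact: cvg_id.
  have h3 := near_bound t (ler_wpDr ler01 (lexx _)).
  have h4 : `|w n s - wlim s| <= e / 3.
    apply: near_bound; rewrite -lerBlDl; apply: le_trans h2.
    by rewrite distrC lerB_dist.
  have -> : wlim t - wlim s = - (w n t - wlim t) + (w n t - w n s) + (w n s - wlim s).
    by rewrite opprB !subrKA.
  apply: le_trans (ler_normD _ _) _.
  have := ler_normD (- (w n t - wlim t)) (w n t - w n s).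
  by rewrite normrN; lra.
(* [w n.+1] is geometrically close both to [wlim] and, by contraction, to [T wlim]. *)
have fixw t : wlim t = T wlim t.
  apply/eqP; rewrite -subr_eq0 -normr_le0.
  apply: (@le_half_pow _ _ (2 * B * expR (K * `|t|))) => n.
  have h1 := wlimP t n.+1.
  have h2 := Tbound _ _ (2 * B * 2^-1 ^+ n) (wC n) wlimC _ (fun s => wlimP s n) t.
  have {}h2 : `|w n.+1 t - T wlim t| <= 2 * B * 2^-1 ^+ n / 2 * expR (K * `|t|).
    by apply: h2; rewrite mulr_ge0 ?exprn_ge0// mulr_ge0.
  rewrite -(subrKA (w n.+1 t)); apply: le_trans (ler_normD _ _) _.
  by move: h1; rewrite distrC exprS; lra.
have [P0 dP] := PP _ (FC _ wlimC).
(* [wlim] is even, so it need not be differentiable at 0; the primitive agrees with it for t >= 0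
   and has a two-sided derivative even at 0. *)
exists (fun t => x0 + P (F \o wlim) t); split=> [|t t0]; first by rewrite P0 addr0.
have -> : x0 + P (F \o wlim) t = wlim t.
  by rewrite [RHS]fixw /T ger0_norm.
have := is_deriveD (is_derive_cst x0 t 1) (dP t t0).
by rewrite add0r.
Unshelve. all: by end_near. Qed.

(** At a maximum point c of |x - z| exp(- K t) on [0, T], the contraction estimate bounds the
    maximum by half of itself. *)
Lemma ode_unique (x z : R -> 'rV[R]_d) :
  {within `[0, +oo[, continuous x} -> {within `[0, +oo[, continuous z} ->
  (forall t : R, 0 < t -> is_derive t 1 x (F (x t))) ->
  (forall t : R, 0 < t -> is_derive t 1 z (F (z t))) ->
  x 0 = z 0 -> forall t, 0 <= t -> x t = z t.
Proof.
move=> xC zC dx dz xz0 T T0.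
pose u (t : R) : 'rV[R]_d := x t - z t.
have uC : {within `[0, T], continuous u}.
  have sub : `[0, T] `<=` `[(0 : R), +oo[ by exact: subset_itvl.
  have xC' : {within `[0, T], continuous x} by exact: continuous_subspaceW xC.
  have zC' : {within `[0, T], continuous z} by exact: continuous_subspaceW zC.
  by move=> t; apply: continuousB; [exact: xC'|exact: zC'].
pose phi (t : R) := `|u t| * expR (- (K * t)).
have phiC : {within `[0, T], continuous phi}.
  have nC : {within `[0, T], continuous (fun t => `|u t|)}.
    by move=> t; apply: continuous_comp; [exact: uC|exact: norm_continuous].
  have eC : continuous (fun t : R => expR (- (K * t))).
    move=> s; apply: (@continuous_comp _ _ _ (fun t : R => - (K * t)) expR).
      by apply: continuousN; apply: continuousM; [exact: cst_continuous|exact: cvg_id].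
    exact: continuous_expR.
  have {}eC : {within `[0, T], continuous (fun t : R => expR (- (K * t)))}.
    exact: continuous_subspaceT.
  by move=> t; exact: (continuousM (nC t) (eC t)).
have [c cT cmax] := EVT_max T0 phiC.
have phiE (t : R) : `|u t| = phi t * expR (K * t).
  by rewrite /phi -mulrA -expRD addrC subrr expR0 mulr1.
have c0 : 0 <= phi c by rewrite mulr_ge0 ?expR_ge0.
have bound := @antiderivative_expR_bound R d u (fun s => F (x s) - F (z s))
  (L * phi c) K T K0 (mulr_ge0 (ltW L0) c0) uC.
have {}bound t : 0 <= t -> t <= T -> `|u t| <= phi c / 2 * expR (K * t).
  have -> : phi c / 2 = L * phi c / K by rewrite /K; field; rewrite gt_eqF.
  apply: bound; first by rewrite /u xz0 subrr.
    by move=> s s0 _; apply: is_deriveB; [exact: dx|exact: dz].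
  move=> s s0 sT; apply: le_trans (FL _ _) _; rewrite -mulrA ler_wpM2l ?(ltW L0)//.
  rewrite -[x s - z s]/(u s) phiE ler_wpM2r ?expR_ge0// cmax//.
  by rewrite in_itv/= !ltW.
have phic0 : phi c = 0.
  move: (cT); rewrite in_itv/= => /andP[cge0 cleT].
  by have := bound c cge0 cleT; rewrite phiE ler_pM2r ?expR_gt0//; lra.
have := bound T T0 (lexx T); rewrite phic0 !mul0r normr_le0 subr_eq0.
by move/eqP.
Qed.

End ODE.

(** * Decrease along solutions *)

Section RightDerivative.
Context {R : realType}.

(** Continuous induction on time. The local hypothesis may assume that the bound by [psi 0] has held
    so far, which is how a solution is known to be still in the sublevel set. *)
Lemma right_nonincreasing_le (psi : R -> R) :
  (forall t : R, 0 <= t -> {for t, continuous psi}) ->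
  (forall t : R, 0 <= t -> (forall s, 0 <= s -> s <= t -> psi s <= psi 0) ->
     \forall h \near 0^'+, psi (t + h) <= psi t) ->
  forall t, 0 <= t -> psi t <= psi 0.
Proof.
move=> psiC psid T T0; rewrite leNgt; apply/negP => psiT.
pose S := [set t | [/\ 0 <= t, t <= T & forall s, 0 <= s -> s <= t -> psi s <= psi 0]].
have S0 : S 0.
  by split=> // s s0 s0'; have -> : s = 0 by apply/eqP; rewrite eq_le s0' s0.
have Sub : has_ubound S by exists T => t [].
pose m := sup S.
have m0 : 0 <= m by exact: ub_le_sup.
have mT : m <= T by apply: ge_sup; [exists 0|move=> t []].
have ltm s : 0 <= s -> s < m -> psi s <= psi 0.
  move=> s0 sm; have [t [_ _ tS] st] := sup_gt (ex_intro _ _ S0) sm.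
  by apply: tS => //; exact: ltW.
have psim : psi m <= psi 0.
  move: m0; rewrite le_eqVlt => /predU1P[<-//|m0].
  (* An excess at m would, by continuity, already be present just before m. *)
  rewrite leNgt; apply/negP => psim.
  have : \forall s \near m^'-, psi 0 < psi s.
    by apply: (cvgr_gt (psi m)) => //; apply: cvg_at_left_filter; exact: psiC (ltW m0).
  have : \forall s \near m^'-, 0 < s < m.
    by near=> s; apply/andP; split; near: s; [exact: nbhs_left_gt|exact: nbhs_left_lt].
  move=> h1 h2; have [s [/andP[s0 sm]]] := filter_ex (filterI h1 h2).
  by rewrite ltNge ltm// ltW.
have Sm s : 0 <= s -> s <= m -> psi s <= psi 0.
  by move=> s0; rewrite le_eqVlt => /predU1P[->//|]; exact: ltm.
have {}mT : m < T.
  by rewrite lt_neqAle mT andbT; apply: contraTneq psiT => <-; rewrite -leNgt.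
have /nbhs_ballP[e /= e0 he] := psid m m0 Sm.
(* Half of e keeps the step inside the open ball; [T - m] keeps it inside [0, T]. *)
pose r := Num.min (e / 2) (T - m).
have r0 : 0 < r by rewrite lt_min divr_gt0//= subr_gt0.
have : S (m + r).
  split; first by rewrite addr_ge0// ltW.
    by rewrite -lerBrDl ge_min lexx orbT.
  move=> s s0 sr; have [sm|ms] := leP s m; first exact: Sm.
  have : psi (m + (s - m)) <= psi m.
    apply: he; last by rewrite subr_gt0.
    rewrite /ball/= sub0r normrN gtr0_norm ?subr_gt0//.
    have re : r <= e / 2 by rewrite ge_min lexx.
    by lra.
  by rewrite addrC subrK => /le_trans; apply.
by move=> /(ub_le_sup Sub); rewrite -/m leNgt ltrDl r0.
Unshelve. all: by end_near. Qed.

Lemma is_derive_right_lt (phi : R -> R) (t v c : R) : is_derive t 1 phi v -> v < c ->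
  \forall h \near 0^'+, phi (t + h) < phi t + c * h.
Proof.
move=> [dphi vE] vc.
have cv : h^-1 *: (phi (h *: (1 : R) + t) - phi t) @[h --> 0^'] --> v by rewrite -vE.
have : \forall h \near 0^', h^-1 *: (phi (h *: (1 : R) + t) - phi t) < c.
  exact: cvgr_lt cv _ vc.
move=> /nbhs_ballP[e /= e0 he]; apply/nbhs_ballP; exists e => //= h eh h0.
have := he h eh (lt0r_neq0 h0).
by rewrite /GRing.scale/= mulr1 mulrC ltr_pdivrMr// ltrBlDl (addrC h).
Qed.

Lemma is_derive_dotp d (c : 'rV[R]_d) (x : R -> 'rV[R]_d) (t : R) v :
  is_derive t 1 x v -> is_derive t 1 (fun s => dotp c (x s)) (dotp c v).
Proof.
move=> /is_derive_rVP xv.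
have := is_derive_sum (fun i => is_deriveZ (c ord0 i) (xv i)).
by rewrite /dotp; congr is_derive; apply/funext => s; rewrite fct_sumE.
Qed.

Lemma is_derive_shift_rV d (x : R -> 'rV[R]_d) (t k : R) v :
  is_derive (t + k) 1 x v -> is_derive t 1 (fun s => x (s + k)) v.
Proof.
move=> /is_derive_rVP xv; apply/is_derive_rVP => i.
have := @is_derive1_comp R (fun s => x s ord0 i) (shift k) t _ 1 (xv i)
  (is_derive_shift t 1 k).
by rewrite mulr1.
Qed.

End RightDerivative.

Lemma vertex_condition_decrease {R : realType} {d : nat} (q : \bar R)
    (X Y : set 'rV[R]_d) (f : 'rV[R]_d -> 'rV[R]_d) (M : R) (n : nat)
    (xs gamma : 'I_n -> 'rV[R]_d) :
  (1 <= q)%E -> 0 < M ->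
  (forall x y, X x -> X y -> qnorm q (f x - f y) <= M * qnorm q (x - y)) ->
  (forall i, X (xs i)) -> compact Y ->
  (forall v, vertices Y v ->
    \sum_i (dotp (f (xs i)) (gamma i) +
      M * qnorm (hoelder_conjugate q) (gamma i) * qnorm q (xs i - v)) < 0) ->
  exists2 c : R, 0 < c &
    forall x, X x -> Y x -> dotp (\sum_i gamma i) (f x) <= - c.
Proof.
move=> q1 M0 fM Xxs cY vert.
(* An empty cell has no vertex to supply the rate, so an arbitrary one is taken. *)
have [->|/set0P Y0] := eqVneq Y set0; first by exists 1.
pose N i := M * qnorm (hoelder_conjugate q) (gamma i).
have N0 i : 0 <= N i by rewrite mulr_ge0 ?qnorm_ge0 ?ltW.
pose phi (x : 'rV[R]_d) :=
  \sum_i (dotp (f (xs i)) (gamma i) + N i * qnorm q (xs i - x)).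
have phiC : continuous phi.
  apply: continuous_sum => i _ x.
  have nC := @qnorm_continuous R d q (xs i) q1 x.
  have c0 (a : R) : {for x, continuous (fun _ : 'rV[R]_d => a)} by exact: cst_continuous.
  exact: (continuousD (c0 _) (continuousM (c0 _) nC)).
have phic : convex_fun phi.
  apply: convex_fun_sum => i u v t t0 t1.
  have := ler_wpM2l (N0 i) (qnorm_dist_convex (xs i) q1 u v t0 t1).
  by lra.
have [v Yv vmax] := convex_max_at_vertex cY Y0 phic phiC.
(* The rate is minus the maximum of [phi] over the cell; being attained at a vertex, that maximum is
   negative. *)
exists (- phi v) => [|x Xx Yx]; first by rewrite oppr_gt0; exact: vert.
rewrite opprK; apply: le_trans (vmax x Yx).
rewrite dotp_suml; apply: ler_sum => i _.
have -> : f x = f (xs i) + (f x - f (xs i)) by rewrite addrC subrK.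
rewrite dotpDr dotpC lerD2l dotpC.
apply: (le_trans (dotp_le_qnorm _ _ q1)).
rewrite /N mulrAC ler_wpM2r ?qnorm_ge0//.
apply: (le_trans (fM _ _ Xx (Xxs i))).
by rewrite -(qnormN (xs i - x))// opprB.
Qed.

(** * Arrival in the target set, and attraction pulled back in time *)

Section Lyapunov.
Context {R : realType} {d : nat}.
Context (q : \bar R) (q1 : (1 <= q)%E) (X : set 'rV[R]_d).
Context (f F : 'rV[R]_d -> 'rV[R]_d) (Ff : forall x, X x -> F x = f x).
Context (x : R -> 'rV[R]_d) (dx : forall t : R, 0 <= t -> is_derive t 1 x (F (x t))).

Lemma solution_continuous (t : R) : 0 <= t -> {for t, continuous x}.
Proof. by move=> t0; apply: is_derive_continuous (dx t0). Qed.

(** By uniqueness for the globally Lipschitz F, x continues after time T as the attracted trajectory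
    z; this gives both the constraint and the limit. *)
Lemma region_of_attraction_backward (L T : R) : 0 < L ->
  (forall u v, `|F u - F v| <= L * `|u - v|) ->
  0 <= T -> (forall s, 0 <= s -> s <= T -> X (x s)) ->
  region_of_attraction q X f (x T) -> region_of_attraction q X f (x 0).
Proof.
move=> L0 FL T0 xX [_ [z [z0 zX zC dz] zlim]].
have xzT : forall t, 0 <= t -> x (t + T) = z t.
  apply: (ode_unique L0 FL (x := fun t => x (t + T))) => //.
  - apply: derivable_within_continuous => t; rewrite in_itv/= andbT => t0.
    by case: (is_derive_shift_rV (dx (addr_ge0 t0 T0))).
  - by move=> t t0; apply: is_derive_shift_rV; exact: dx (addr_ge0 (ltW t0) T0).
  - by move=> t t0; rewrite Ff; [exact: dz|exact: zX (ltW t0)].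
  - by rewrite add0r z0.
have xX' t : 0 <= t -> X (x t).
  move=> t0; have [tT|Tt] := leP t T; first exact: xX.
  have t0' : 0 <= t - T by rewrite subr_ge0 ltW.
  by rewrite -(subrK T t) xzT//; exact: zX.
split; first exact: xX'.
exists x; first split=> //.
- apply: derivable_within_continuous => t; rewrite in_itv/= andbT => t0.
  by case: (dx t0).
- by move=> t t0; rewrite -Ff; [exact: dx (ltW t0)|exact: xX' (ltW t0)].
apply/cvgrPdist_lt => e e0.
have /cvgrPdist_lt/(_ e e0)[N [Nr zN]] := zlim.
(* The threshold N may be negative; the maximum with 0 puts t after T. *)
exists (Num.max N 0 + T); split; first exact: num_real.
move=> t /= Nt.
have t0 : 0 <= t - T.
  by rewrite subr_ge0 ltW// (le_lt_trans _ Nt)// lerDr le_max lexx orbT.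
have -> : x t = z (t - T) by rewrite -xzT// subrK.
by apply: zN => /=; rewrite ltrBrDr (le_lt_trans _ Nt)// lerD2r le_max lexx.
Qed.

Context (A : set 'rV[R]_d) (I : finType) (Y : I -> set 'rV[R]_d).
Context (g : I -> 'rV[R]_d) (b : I -> R) (V : 'rV[R]_d -> R) (LV c a : R).

(** If A were never reached with V < a up to that time, V would drop at rate c for ever, against its
    lower bound on the bounded set X. *)
Lemma lyapunov_reaches_target :
  bounded_set X -> open X -> closed A ->
  (forall k, closed (Y k)) -> X `\` A `<=` \bigcup_k Y k ->
  (forall k u, Y k u -> V u = dotp (g k) u + b k) ->
  qnorm_lipschitz q LV setT V -> 0 < c ->
  (forall k u, X u -> Y k u -> dotp (g k) (f u) < - c) ->
  [set u | V u < a] `<=` X -> V (x 0) < a ->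
  exists2 T : R, 0 <= T & A (x T) /\ forall s, 0 <= s -> s <= T -> V (x s) < a.
Proof.
move=> bX oX cA cY XAY VE VL c0 gf VX x0a; apply: contrapT => noT.
have VC := qnorm_lipschitz_continuous q1 VL.
(* The bound up to time t gives V < a so far, hence x t is in X and, by [noT], outside A; only there
   is a decrease known. *)
have Vdec t : 0 <= t -> V (x t) + c * t <= V (x 0) + c * 0.
  move: t; apply: right_nonincreasing_le => [t t0|t t0 tdec].
    apply: continuousD.
      by apply: continuous_comp; [exact: solution_continuous|exact: VC].
    by apply: continuousM; [exact: cst_continuous|exact: cvg_id].
  have Va s : 0 <= s -> s <= t -> V (x s) < a.
    move=> s0 st; apply: le_lt_trans x0a; have := tdec s s0 st.
    by rewrite mulr0 addr0; apply: le_trans; rewrite lerDl mulr_ge0// ltW.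
  have Xt : X (x t) by apply: VX; exact: Va.
  have nAt : ~ A (x t) by move=> At; apply: noT; exists t.
  have cvx : x (t + h) @[h --> 0^'+] --> x t.
    apply: cvg_at_right_filter; rewrite -[in x t](addr0 t).
    apply: (@continuous_comp _ _ _ (fun h => t + h) x 0).
      by apply: continuousD; [exact: cst_continuous|exact: cvg_id].
    by rewrite addr0; exact: solution_continuous.
  have nearXA : \forall h \near 0^'+, (X `\` A) (x (t + h)).
    have /cvx : nbhs (x t) (X `\` A).
      apply: open_nbhs_nbhs; split; last by split.
      by rewrite setDE; apply: openI => //; exact: closed_openC.
    exact.
  (* V may fail to be differentiable across cell boundaries, and x (t + h) may switch cells as h
     varies. A closed cell without x t is avoided for small h; on a cell holding both points V is
     one affine function, whose derivative along x is below - c. *)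
  have nearY : \forall h \near 0^'+, forall k, Y k (x (t + h)) ->
      V (x (t + h)) <= V (x t) - c * h.
    apply: filter_forall => k; have [Yk|nYk] := pselect (Y k (x t)).
      have := is_derive_right_lt (is_derive_dotp (g k) (dx t0)) (c := - c).
      rewrite Ff// => /(_ (gf k _ Xt Yk)); apply: filterS => h lth Ykh.
      by rewrite (VE k _ Yk) (VE k _ Ykh); lra.
    have /cvx : nbhs (x t) (~` Y k).
      by apply: open_nbhs_nbhs; split => //; exact: closed_openC.
    move=> nY; have {}nY : \forall h \near 0^'+, ~ Y k (x (t + h)) by exact: nY.
    by apply: filterS nY => h nYh /nYh.
  apply: filterS2 nearXA nearY => h /XAY[k _ Ykh] /(_ k Ykh).
  by rewrite mulrDr; lra.
have {}Vdec t : 0 <= t -> V (x t) <= V (x 0) - c * t.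
  by move=> /Vdec; rewrite mulr0 addr0 lerBrDr.
have [B B0 XB] := ex_strict_bound_gt0 bX.
(* A lower bound of V on X, by the Lipschitz comparison with the value at 0. *)
pose m := V 0 - `|LV| * (qnorm q (const_mx 1 : 'rV[R]_d) * B).
have Vm u : X u -> m <= V u.
  move=> Xu; have := VL 0 u Logic.I Logic.I; rewrite sub0r qnormN// => Vu.
  rewrite /m lerBlDr -lerBlDl; apply: le_trans (ler_norm _) (le_trans Vu _).
  apply: (@le_trans _ _ (`|LV| * qnorm q u)).
    by rewrite ler_wpM2r ?qnorm_ge0// ler_norm.
  rewrite ler_wpM2l//; apply: le_trans (qnorm_le_norm _ q1) _.
  by rewrite ler_wpM2l ?qnorm_ge0//; exact: ltW (XB u Xu).
have mx0 : m <= V (x 0) by apply: Vm; exact: VX.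
(* At this time V (x 0) - c t equals m - c, which is below the lower bound m. *)
pose t := (V (x 0) - m) / c + 1.
have t0 : 0 <= t by rewrite addr_ge0// divr_ge0 ?subr_ge0// ltW.
have Vt := Vdec t t0.
have Xt : X (x t).
  by apply: VX; apply: le_lt_trans Vt (le_lt_trans _ x0a); rewrite gerBl mulr_ge0// ltW.
have := le_trans (Vm _ Xt) Vt.
have -> : c * t = V (x 0) - m + c by rewrite /t; field; rewrite gt_eqF.
by lra.
Qed.

End Lyapunov.

(** Every small enough positive c suits a given index, and finitely many such conditions hold
    together near 0; taking c below the given constants makes the inequality strict. *)
Lemma finite_uniform_lt0 {R : realType} (I : finType) (T : Type) (P : I -> T -> Prop)
    (h : I -> T -> R) :
  (forall k, exists2 c, 0 < c & forall u, P k u -> h k u <= - c) ->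
  exists2 c, 0 < c & forall k u, P k u -> h k u < - c.
Proof.
move=> hk.
have : \forall c \near (0 : R)^'+, forall k, forall u, P k u -> h k u < - c.
  apply: filter_forall => k; have [c c0 kc] := hk k.
  have := nbhs_right_lt c0; apply: filterS => e ec u /kc hu.
  by apply: le_lt_trans hu _; rewrite ltrN2.
move=> near_c; have [c [c0 cP]] := filter_ex (filterI (nbhs_right_gt (0 : R)) near_c).
by exists c.
Qed.

Theorem theorem8 (R : realType) (d : nat) (q : \bar R) (hq : (1 <= q)%E)
  (* the system *)
  (X : set 'rV[R]_d) (hXbounded : bounded_set X) (hXopen : open X)
  (f : 'rV[R]_d -> 'rV[R]_d)
  (M : R) (hM : 0 < M)
  (hfM : forall x y, X x -> X y -> qnorm q (f x - f y) <= M * qnorm q (x - y))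
  (hX0 : X 0) (hf0 : f 0 = 0)
  (hfunique : forall x, X x -> f x = 0 -> x = 0)
  (hstable : locally_asymptotically_stable0 q X f)
  (* the dataset *)
  (n : nat) (xs fs : 'I_n -> 'rV[R]_d)
  (hxs : forall i, X (xs i)) (hfs : forall i, fs i = f (xs i))
  (* the set A *)
  (A : set 'rV[R]_d) (hAcompact : compact A)
  (hAR : A `<=` interior (region_of_attraction q X f))
  (h0A : interior A 0)
  (hXpolytope : polytope (closure X)) (hApolytope : polytope A)
  (* the tessellation; the index ord0 is that of A *)
  (m : nat) (Y : 'I_m.+1 -> set 'rV[R]_d) (hY0 : Y ord0 = A)
  (hY : forall k, k != ord0 -> convex_polytope (Y k))
  (hYcover : closure (X `\` A) = \bigcup_(k in [set k | k != ord0]) Y k)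
  (hYint : forall k k', k != ord0 -> k' != ord0 -> k != k' ->
     interior (Y k) `&` interior (Y k') = set0)
  (nu : 'I_m.+1 -> nat) (y : forall k : 'I_m.+1, 'I_(nu k) -> 'rV[R]_d)
  (hy : forall k, k != ord0 -> [set y k l | l in [set: 'I_(nu k)]] = vertices (Y k))
  (* the continuous piecewise affine function, and its Lipschitz extension *)
  (g : 'I_m.+1 -> 'rV[R]_d) (b : 'I_m.+1 -> R) (V : 'rV[R]_d -> R)
  (hV : forall k x, Y k x -> V x = dotp (g k) x + b k)
  (hVcont : {within \bigcup_k Y k, continuous V})
  (hVlip : exists L : R, qnorm_lipschitz q L setT V)
  (hVext : forall L : R,
     qnorm_lipschitz q L (\bigcup_k Y k) V -> qnorm_lipschitz q L setT V)
  (* the conditions at the vertices *)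
  (hgamma : forall k, k != ord0 ->
     exists gamma : 'I_n -> 'rV[R]_d,
       \sum_i gamma i = g k /\
       forall l : 'I_(nu k),
         \sum_i (dotp (fs i) (gamma i) +
           M * qnorm (hoelder_conjugate q) (gamma i) * qnorm q (xs i - y k l))
         < 0) :
  forall a : R, [set x | V x < a] `<=` X ->
    [set x | V x < a] `<=` region_of_attraction q X f.
Proof.
have q1 := hq.
pose C := qnorm q (const_mx 1 : 'rV[R]_d).
have C0 : 0 <= C by exact: qnorm_ge0.
(* A Lipschitz constant of f for the maximum norm; the added 1 makes it positive even when [C]
   vanishes. *)
pose L := M * C + 1.
have L0 : 0 < L by rewrite ltr_wpDl// mulr_ge0// ltW.
have fL u v : X u -> X v -> `|f u - f v| <= L * `|u - v|.
  move=> Xu Xv; apply: le_trans (norm_le_qnorm _ hq) _.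
  apply: le_trans (hfM _ _ Xu Xv) _.
  apply: le_trans (ler_wpM2l (ltW hM) (qnorm_le_norm _ hq)) _.
  by rewrite mulrA ler_wpM2r// lerDl.
have [F [Ff FL]] := lipschitz_extension (ltW L0) (ex_intro _ _ hX0) fL.
(* The decrease is assumed only on the cells tessellating X \ A, so the index of A is left out. *)
pose I := {k : 'I_m.+1 | k != ord0}.
have cY (k : I) : compact (Y (val k)).
  by apply: polytope_compact; have [] := hY (val k) (valP k).
have [c c0 gf] : exists2 c : R, 0 < c & forall (k : I) u, X u /\ Y (val k) u ->
    dotp (g (val k)) (f u) < - c.
  apply: finite_uniform_lt0 => k.
  have [gamma [gammaE gammaP]] := hgamma (val k) (valP k).
  have [v vk|c c0 cP] := vertex_condition_decrease hq hM hfM hxs (cY k) (gamma := gamma).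
    have : [set y (val k) l | l in [set: 'I_(nu (val k))]] v by rewrite hy ?(valP k).
    move=> [l _ <-]; have := gammaP l.
    by under eq_bigr do rewrite hfs.
  by exists c => // u [Xu Yu]; rewrite -gammaE; exact: cP.
move=> a VX x0 x0a.
(* [x] solves the extended equation and is not yet known to stay in X. *)
have [x [x00 dx]] := ode_exists L0 FL x0.
have [LV VL] := hVlip.
have XAY : X `\` A `<=` \bigcup_(k : I) Y (val k).
  move=> u /subset_closure; rewrite hYcover => -[k k0 Yk].
  by exists (exist _ k k0).
have [T T0 [AT VT]] : exists2 T : R, 0 <= T &
    A (x T) /\ forall s, 0 <= s -> s <= T -> V (x s) < a.
  apply: (@lyapunov_reaches_target R d q hq X f F Ff x dx A I (Y \o val)
    (g \o val) (b \o val) V LV c a) => //.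
  - by apply: compact_closed => //; exact: norm_hausdorff.
  - by move=> k; apply: compact_closed (cY k); exact: norm_hausdorff.
  - by move=> k u /hV.
  - by move=> k u Xu Yu; exact: gf.
  - by rewrite x00.
(* x T lies in A, hence in the region of attraction, and V < a keeps x in X up to time T. *)
rewrite -x00; apply: (region_of_attraction_backward Ff dx L0 FL T0).
  by move=> s s0 sT; apply: VX; exact: VT.
exact: interior_subset (hAR _ AT).
Qed.
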